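(* Let $Y^{f,\mu}_\pi(t)=N^f_\pi(G_\mu(t))$, $t\ge0$, be the generalized subordinated multiplicative Poisson process with Bernstein function $f$, Poisson intensity $\lambda>0$, geometric parameter $\mu>0$ and i.i.d. factors $X_1,X_2,\dots$, and let $V_m=X_1X_2\cdots X_m$. Then for $y\in\mathbb{R}$ and $t\ge0$, $$\mathbb{P}[Y^{f,\mu}_\pi(t)\le y]=\frac{1}{1+\mu t(1-e^{-f(\lambda)})}\,\mathbb{I}_{\{y\ge1\}}+\sum_{m=1}^\infty\frac{(-1)^m}{m!}\,\mathbb{P}[V_m\le y]\,\frac{d^m}{du^m}\left(\frac{1}{1+\mu t(1-e^{-f(\lambda u)})}\right)\Bigg|_{u=1}.$$
   Context: $\{D^f(t)\}_{t\ge0}$ is a Lévy subordinator (non-decreasing Lévy process) with Laplace transform $\mathbb{E}[e^{-sD^f(t)}]=e^{-tf(s)}$, where $f(s)=bs+\int_0^\infty(1-e^{-sx})\,\nu(dx)$, $b\ge0$, is a Bernstein function, and $\nu$ is a Lévy measure on the positive half-line with $\int_0^\infty (x\wedge 1)\,\nu(dx)<\infty$ and infinite total mass. $\{N(t)\}_{t\ge0}$ is a homogeneous Poisson process with intensity $\lambda>0$, independent of $D^f$, and $N^f(t)=N(D^f(t))$ is the subordinated Poisson process. $X_1,X_2,\dots$ are i.i.d. real random variables independent of $N^f$. The generalized multiplicative compound Poisson process is $N^f_\pi(t)=\prod_{i=1}^{N^f(t)}X_i$, $t\ge0$ (empty product $=1$). The geometric counting process $\{G_\mu(t)\}_{t\ge0}$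 with parameter $\mu>0$ is the mixed Poisson process whose random rate is exponentially distributed with mean $\mu$, so $\mathbb{P}[G_\mu(t)=k]=\frac{1}{1+\mu t}\left(\frac{\mu t}{1+\mu t}\right)^k$, $k=0,1,2,\dots$; it is independent of $N^f_\pi$. $\mathbb{I}$ denotes the indicator function. *)

(* Defs.v *)
From mathcomp Require Import all_boot all_order all_algebra.
From mathcomp Require Import all_classical all_reals all_analysis.

Set Implicit Arguments.
Unset Strict Implicit.
Unset Printing Implicit Defensive.

Import Order.TTheory GRing.Theory Num.Theory.
Import numFieldNormedType.Exports.

Local Open Scope classical_set_scope.
Local Open Scope ring_scope.

(* Processes in continuous time are families indexed by all of R; only their
   restriction to the times t >= 0 is ever constrained or used. *)

Definition mutually_independent (d : measure_display) (T : measurableType d)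
    (R : realType) (P : probability T R)
    (d' : measure_display) (E : measurableType d')
    (I : choiceType) (X : I -> T -> E) : Prop :=
  forall (s : seq I) (B : I -> set E), uniq s ->
    (forall i, i \in s -> measurable (B i)) ->
    (P (\bigcap_(i in [set` s]) X i @^-1` B i) =
     \prod_(i <- s) P (X i @^-1` B i))%E.

Definition sigma_process (T : Type) (d' : measure_display)
    (E : measurableType d') (I : Type) (J : set I) (X : I -> T -> E) :
    set (set T) :=
  <<s \bigcup_(i in J) preimage_set_system [set: T] (X i) measurable >>.

Definition independent_processes (d : measure_display) (T : measurableType d)
    (R : realType) (P : probability T R)
    (d1 d2 : measure_display) (E1 : measurableType d1) (E2 : measurableType d2)
    (I1 I2 : Type) (J1 : set I1) (X1 : I1 -> T -> E1)
    (J2 : set I2) (X2 : I2 -> T -> E2) : Prop :=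
  forall A B : set T, sigma_process J1 X1 A -> sigma_process J2 X2 B ->
    (P (A `&` B) = P A * P B)%E.

(* An infinite sequence of times costs no generality: mutual independence only
   concerns finite subfamilies, and any t_0 <= ... <= t_n can be prolonged. *)
Definition independent_increments (d : measure_display) (T : measurableType d)
    (R : realType) (P : probability T R) (X : R -> T -> R) : Prop :=
  forall t : nat -> R, 0 <= t 0%N -> nondecreasing_seq t ->
    mutually_independent P (fun i w => X (t i.+1) w - X (t i) w).

Definition stationary_increments (d : measure_display) (T : measurableType d)
    (R : realType) (P : probability T R) (X : R -> T -> R) : Prop :=
  forall (s t : R) (B : set R), 0 <= s -> 0 <= t -> measurable B ->
    P [set w | B (X (s + t) w - X s w)] = P [set w | B (X t w - X 0 w)].

Definition cadlag (R : realType) (E : topologicalType) (x : R -> E) : Prop :=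
  (forall t, 0 <= t -> x u @[u --> t^'+] --> x t) /\
  (forall t, 0 < t -> exists l : E, x u @[u --> t^'-] --> l).

Definition levy_process (d : measure_display) (T : measurableType d)
    (R : realType) (P : probability T R) (X : R -> T -> R) : Prop :=
  [/\ forall w, X 0 w = 0,
      independent_increments P X,
      stationary_increments P X &
      forall w, cadlag (X ^~ w)].

Definition levy_subordinator (d : measure_display) (T : measurableType d)
    (R : realType) (P : probability T R) (D : R -> T -> R) : Prop :=
  levy_process P D /\
  (forall w s t, 0 <= s -> s <= t -> D s w <= D t w).

(* Levy measure of a subordinator with infinite activity, viewed as a measure
   on R carried by the positive half-line. *)
Definition levy_measure_pos (R : realType) (nu : {measure set R -> \bar R}) :
    Prop :=
  [/\ nu `]-oo, 0]%classic = 0%E,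
      (\int[nu]_(x in `]0%R, +oo[) (Num.min x 1)%:E < +oo)%E &
      nu `]0, +oo[%classic = +oo%E].

Definition bernstein (R : realType) (b : R) (nu : {measure set R -> \bar R})
    (s : R) : R :=
  b * s + \int[nu]_(x in `]0, +oo[) (1 - expR (- (s * x))).

Definition counting_process (R : realType) (T : Type) (N : R -> T -> nat) :
    Prop :=
  [/\ forall w, N 0 w = 0%N,
      forall w s t, 0 <= s -> s <= t -> (N s w <= N t w)%N &
      forall w, cadlag (N ^~ w)].

Definition poisson_process (d : measure_display) (T : measurableType d)
    (R : realType) (P : probability T R) (lambda : R) (N : R -> T -> nat) :
    Prop :=
  [/\ counting_process N,
      independent_increments P (fun t w => (N t w)%:R) &
      forall (s t : R) (k : nat), 0 <= s -> s < t ->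
        P [set w | (N t w - N s w)%N = k] =
        (poisson_pmf (lambda * (t - s)) k)%:E].

(* Mixed Poisson process with random rate L, exponentially distributed with
   mean mu (hence with rate mu^-1): conditionally on L, the increments over
   disjoint intervals are independent and Poisson distributed with intensity L.
   The conditional law is expressed by integrating over the events {L in B}.
   Times are strictly increasing as poisson_pmf is only meaningful for a
   positive parameter. *)
Definition geometric_counting_process (d : measure_display)
    (T : measurableType d) (R : realType) (P : probability T R) (mu : R)
    (G : R -> T -> nat) : Prop :=
  counting_process G /\
  exists L : {RV P >-> R},
    (forall B : set R, measurable B ->
       P (L @^-1` B) = exponential_prob mu^-1 B) /\
    (forall (n : nat) (t : nat -> R) (k : nat -> nat) (B : set R),
       0 <= t 0%N -> increasing_seq t -> measurable B ->
       P ([set w | forall i, (i < n)%N ->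
                     (G (t i.+1) w - G (t i) w)%N = k i] `&` L @^-1` B) =
       (\int[P]_(w in L @^-1` B)
          (\prod_(i < n) poisson_pmf (L w * (t i.+1 - t i)%R) (k i))%:E)%E).

Definition subordinated (R : realType) (T : Type) (N : R -> T -> nat)
    (D : R -> T -> R) : R -> T -> nat :=
  fun t w => N (D t w) w.

(* The factors X_1, X_2, ... are indexed from 0: X i stands for X_{i+1}. *)
Definition partial_product (R : realType) (T : Type) (X : nat -> T -> R)
    (m : nat) : T -> R :=
  fun w => \prod_(i < m) X i w.

Definition mult_compound (R : realType) (T : Type) (X : nat -> T -> R)
    (M : R -> T -> nat) : R -> T -> R :=
  fun t w => partial_product X (M t w) w.

Definition time_changed (R : realType) (T : Type) (Z : R -> T -> R)
    (G : R -> T -> nat) : R -> T -> R :=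
  fun t w => Z (G t w)%:R w.

(* Main.v *)
(** Write g_k = P(G_mu(t) = k), a_{k,m} = P(N^f(k) = m) and v_m = P(V_m <= y).
    Conditioning on G_mu(t), then on N^f(k), and exchanging the two sums of
    nonnegative terms gives P(Y <= y) = sum_m v_m p_m with
    p_m = sum_k g_k a_{k,m}.  It remains to see that (-1)^m p_m is the m-th
    Taylor coefficient at 1 of h(u) = 1 / (1 + mu t (1 - e^{-f(lambda u)})).
    Discretising D^f(k) from the right and using right-continuity of N,
    a_{k,m} is the mean of the Poisson weight of parameter lambda D^f(k), so
    sum_m a_{k,m} x^m = E[e^{-lambda (1 - x) D^f(k)}] = e^{-k f(lambda (1 - x))}
    with a remainder after n terms of size at most |x|^n, uniformly in k.
    Averaging over k yields sum_m p_m x^m = h(1 - x) for |x| < 1, since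
    sum_k g_k z^k = 1 / (1 + mu t (1 - z)), and the power series may be
    differentiated term by term. *)

From HB Require Import structures.
Require Import Defs.
From mathcomp Require Import all_boot all_order all_algebra.
From mathcomp Require Import all_classical all_reals all_analysis.
From mathcomp Require Import measurable_realfun lra ring.
Import Order.TTheory GRing.Theory Num.Theory.
Import numFieldNormedType.Exports.
Local Open Scope classical_set_scope.
Local Open Scope ring_scope.

Set Implicit Arguments.
Unset Strict Implicit.
Unset Printing Implicit Defensive.

(** * Power series on the unit disk and their derivatives *)

(** Choose |x| < r < s < 1. Since n + 1 is at most a constant times (s / r)^n, the terms (n + 1)
    |c_(n+1)| r^n are dominated by those of the series at s, which converges absolutely; convergence
    at r then passes to x. *)
Lemma pseries_diffs_cvg_unit_disk (R : realType) (c : R^nat) :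
  (forall x, `|x| < 1 -> cvgn (pseries c x)) ->
  forall x, `|x| < 1 -> cvgn (pseries (pseries_diffs c) x).
Proof.
move=> hc x x1.
pose r := (1 + `|x|) / 2; pose s := (1 + r) / 2.
have x0 : 0 <= `|x| by [].
have xr : `|x| < r by rewrite /r; lra.
have r1 : r < 1 by rewrite /r; lra.
have rs : r < s by rewrite /s; lra.
have s1 : s < 1 by rewrite /s; lra.
have r0 : 0 < r by lra.
have s0 : 0 < s by lra.
have xx : `|x| < `|r| by rewrite (gtr0_norm r0).
apply: (@is_cvg_pseries_inside _ _ r) => //.
have hs : cvgn (pseries (fun i => `|c i|) s).
  apply: (@is_cvg_pseries_inside_norm _ _ ((1 + s) / 2)).
    by apply: hc; rewrite ger0_norm; lra.
  by rewrite !ger0_norm; lra.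
(* With q = s / r, Bernoulli gives n + 1 <= (1 + 1 / (q - 1)) q^n; the division by s absorbs the
   extra factor in s^(n+1). *)
pose K := (1 + (s / r - 1)^-1) / s.
have sr : 1 < s / r by rewrite ltr_pdivlMr // mul1r.
have K0 : 0 <= K.
  by rewrite divr_ge0 ?ltW // addr_gt0 // invr_gt0 subr_gt0.
apply: normed_cvg.
apply: (@series_le_cvg _ _ (fun n => K * (`|c n.+1| * s ^+ n.+1))).
- by move=> n /=; exact: normr_ge0.
- move=> n /=; apply: mulr_ge0 => //; apply: mulr_ge0 => //.
  exact/exprn_ge0/ltW.
- move=> n /=.
  rewrite /pseries_diffs normrM normrX (gtr0_norm r0) normrM normr_nat.
  have -> : K * (`|c n.+1| * s ^+ n.+1) =
     ((1 + (s / r - 1)^-1) * (s / r) ^+ n) * (`|c n.+1| * r ^+ n).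
    have -> : s ^+ n.+1 = s * ((s / r) ^+ n * r ^+ n).
      by rewrite -exprMn divfK ?gt_eqF // exprS.
    by rewrite /K; field; rewrite !gt_eqF //; lra.
  rewrite -mulrA; apply: ler_wpM2r.
    by rewrite mulr_ge0 // exprn_ge0 // ltW.
  (* Bernoulli's inequality bounds n + 1 by a multiple of (s / r)^n. *)
  have /(_ n) B : forall n, 1 + n%:R * (s / r - 1) <= (s / r) ^+ n.
    elim=> [|k IH]; first by rewrite mul0r addr0 expr0.
    rewrite exprS.
    apply: (@le_trans _ _ ((s / r) * (1 + k%:R * (s / r - 1)))); last first.
      by apply: ler_wpM2l => //; apply/ltW/(lt_trans _ sr).
    rewrite -subr_ge0 -natr1; set q := s / r.
    have -> : q * (1 + k%:R * (q - 1)) - (1 + (k%:R + 1) * (q - 1)) =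
        k%:R * (q - 1) ^+ 2 by ring.
    by rewrite mulr_ge0 // sqr_ge0.
  rewrite -natr1 mulrDl mul1r. rewrite addrC lerD //.
    by apply: (le_trans _ B); rewrite lerDl mulr_ge0 //; lra.
  rewrite ler_pdivlMl ?subr_gt0 // mulrC.
  by apply: (le_trans _ B); rewrite lerDr.
(* The dominating series is, up to the factor K, the series at s shifted by one index and deprived
   of its constant term. *)
have -> : series (fun n => K * (`|c n.+1| * s ^+ n.+1)) =
    K \*: (fun n => series (fun i => `|c i| * s ^+ i) n.+1 - `|c 0%N|).
  apply/funext => n; rewrite /series /= -mulr_sumr; congr (_ * _).
  by rewrite big_nat_recl // expr0 mulr1 addrC addKr.
apply: is_cvgZr; apply: is_cvgB; last exact: is_cvg_cst.
apply/cvg_ex; exists (limn (pseries (fun i => `|c i|) s)).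
by rewrite -/(pseries _ _) (cvg_shiftS (pseries (fun i => `|c i|) s)).
Qed.

(** Near 1, the k-th derivative of h at u is (-1)^k times the k-fold termwise derivative of the
    series at 1 - u, the sign coming from the chain rule. At u = 1 only the constant coefficient m!
    c_m survives. Derivability is stated separately because [derive1n] is total and its value alone
    would not ensure it. *)
Lemma derive1n_pseries_onem (R : realType) (c : R^nat) (h : R -> R) :
  (forall x, `|x| < 1 -> pseries c x @ \oo --> h (1 - x)) ->
  forall m, derivable (derive1n m h) 1 1 /\
    derive1n m h 1 = (-1) ^+ m * m`!%:R * c m.
Proof.
move=> hc m.
have cc k x : `|x| < 1 -> cvgn (pseries (iter k (@pseries_diffs R) c) x).
  elim: k x => [|k IH] x x1 /=; last exact: pseries_diffs_cvg_unit_disk.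
  by apply/cvg_ex; exists (h (1 - x)); exact: hc.
have D (k : nat) (u : R) : `|1 - u| < 1 -> is_derive u (1 : R)
    (fun u : R =>
      (-1) ^+ k * limn (pseries (iter k (@pseries_diffs R) c) (1 - u)))
    ((-1) ^+ k.+1 * limn (pseries (iter k.+1 (@pseries_diffs R) c) (1 - u))).
  move=> u1.
  have ? : 0 <= `|1 - u| by [].
  have e0 : (1 + `|1 - u|) / 2 < 1 by lra.
  have e1 : `|(1 + `|1 - u|) / 2| < 1 by rewrite ger0_norm; lra.
  have d1 : is_derive (1 - u) (1 : R)
     (fun x => limn (pseries (iter k (@pseries_diffs R) c) x))
     (limn (pseries (pseries_diffs (iter k (@pseries_diffs R) c)) (1 - u))).
    (* Termwise differentiation asks for convergence of the series and of its first two formal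
       derivatives at a point of modulus larger than |1 - u|; the midpoint between |1 - u| and 1
       serves. *)
    apply: (@pseries_snd_diffs _ _ ((1 + `|1 - u|) / 2)).
    - exact: cc.
    - exact: (cc k.+1).
    - exact: (cc k.+2).
    - by rewrite [ltRHS]ger0_norm; lra.
  have d2 : is_derive u (1 : R) (fun u : R => 1 - u) (-1).
    by apply: is_derive_eq; rewrite add0r mul1r.
  have d3 := @is_derive1_comp R
    (fun x => limn (pseries (iter k (@pseries_diffs R) c) x))
    (fun u : R => 1 - u) u _ _ d1 d2.
  have := @is_deriveZ _ _ _ _ ((-1) ^+ k) _ _ _ d3.
  rewrite /=; set L := limn _; move=> dd; apply: (is_derive_eq dd).
  by rewrite exprSr /GRing.scale /=; ring.
have E (k : nat) (u : R) : `|1 - u| < 1 -> derive1n k h u =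
    (-1) ^+ k * limn (pseries (iter k (@pseries_diffs R) c) (1 - u)).
  elim: k u => [|k IH] u u1.
    rewrite /derive1n /= mul1r; apply/esym/cvg_lim => //.
    by have := hc _ u1; rewrite subKr.
  (* The induction hypothesis can be differentiated at u because it holds on a whole neighbourhood
     of u. *)
  have N : \forall v \near u, `|1 - v : R| < 1.
    have : (fun v : R => `|1 - v|) @ u --> `|1 - u|.
      by apply: cvg_norm; apply: cvgB; [exact: cvg_cst|exact: cvg_id].
    by move/cvgr_lt; apply.
  rewrite derive1nS derive1E.
  have -> : 'D_1 (derive1n k h) u = 'D_1 (fun u : R =>
     (-1) ^+ k * limn (pseries (iter k (@pseries_diffs R) c) (1 - u))) u.
    apply: near_eq_derive; near=> v; apply: IH; near: v; exact: N.
  by have [_ ->] := D k u u1.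
have n1 : `|1 - 1 : R| < 1 by rewrite subrr normr0.
have c0 (f : R^nat) : limn (pseries f 0) = f 0%N.
  apply/cvg_lim => //; rewrite -(cvg_shiftS _); apply: cvg_near_cst.
  apply: nearW => n; rewrite /pseries /series /= big_nat_recl // expr0 mulr1.
  by rewrite big1 ?addr0 // => i _; rewrite exprS mul0r mulr0.
split.
  have N : \forall v \near (1 : R), `|1 - v| < 1.
    have : (fun v : R => `|1 - v|) @ (1 : R) --> `|1 - 1 : R|.
      by apply: cvg_norm; apply: cvgB; [exact: cvg_cst|exact: cvg_id].
    by move/cvgr_lt; apply.
  apply: near_eq_derivable; last by have [dd _] := D m 1 n1; exact: dd.
  by near=> v; apply/esym/E; near: v; exact: N.
rewrite E // subrr c0 -mulrA; congr (_ * _).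
(* All coefficients are needed for the induction on m, as each formal derivative shifts the index; k
   = 0 gives m!. *)
suff -> : forall k, iter m (@pseries_diffs R) c k =
    ((k + m) ^_ m)%:R * c (k + m)%N.
  by rewrite add0n ffactnn.
elim: (m) => [|j IH] k /=; first by rewrite addn0 ffactn0 mul1r.
rewrite {1}/pseries_diffs IH addSnnS mulrA -natrM; congr (_%:R * _).
by rewrite ffactnSr mulnC -addSnnS addnK.
Unshelve. all: by end_near. Qed.

(** * Poisson weights and their generating function *)

(* Agrees with [poisson_pmf] for s > 0 but is also correct at s = 0, where it is
   the point mass at 0 while [poisson_pmf] is constantly 1. *)
Definition poisson_weight (R : realType) (s : R) (m : nat) : R :=
  exp_coeff s m * expR (- s).

Lemma poisson_weight_ge0 (R : realType) (s : R) m :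
  0 <= s -> 0 <= poisson_weight s m.
Proof. by move=> s0; rewrite mulr_ge0 ?expR_ge0 // exp_coeff_ge0. Qed.

Lemma poisson_pmfE (R : realType) (s : R) m :
  0 < s -> poisson_pmf s m = poisson_weight s m.
Proof. by rewrite /poisson_pmf => ->. Qed.

Lemma series_exp_coeff_le (R : realType) (s : R) n :
  0 <= s -> series (exp_coeff s) n <= expR s.
Proof.
move=> s0; apply: (nondecreasing_cvgn_le _ (is_cvg_series_exp_coeff s)).
by apply/nondecreasing_seqP => k; rewrite seriesSr lerDl exp_coeff_ge0.
Qed.

Lemma poisson_weight_le1 (R : realType) (s : R) m :
  0 <= s -> poisson_weight s m <= 1.
Proof.
move=> s0; rewrite /poisson_weight expRN ler_pdivrMr ?expR_gt0 // mul1r.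
apply: (le_trans _ (series_exp_coeff_le m.+1 s0)).
rewrite seriesSr lerDr; apply: sumr_ge0 => i _; exact: exp_coeff_ge0.
Qed.

Lemma sum_poisson_weight_exprE (R : realType) (s x : R) n :
  \sum_(0 <= m < n) poisson_weight s m * x ^+ m =
  expR (- s) * series (exp_coeff (s * x)) n.
Proof.
rewrite /series /= mulr_sumr; apply: eq_bigr => i _.
by rewrite /poisson_weight /exp_coeff /= exprMn; ring.
Qed.

Lemma cvg_poisson_weight_pgf (R : realType) (s x : R) :
  \sum_(0 <= m < n) poisson_weight s m * x ^+ m @[n --> \oo] -->
  expR (- (s * (1 - x))).
Proof.
have -> : - (s * (1 - x)) = - s + s * x by ring.
rewrite expRD; under eq_fun do rewrite sum_poisson_weight_exprE.
by apply: cvgMr; exact: is_cvg_series_exp_coeff.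
Qed.

Lemma nneseries_poisson_weight_pgf (R : realType) (s z : R) :
  (\sum_(m <oo) (poisson_weight s m * z ^+ m)%:E =
  (expR (- (s * (1 - z))))%:E)%E.
Proof.
apply/cvg_lim => //.
under eq_fun do rewrite sumEFin.
by apply/fine_cvgP; split; [exact: nearW|exact: cvg_poisson_weight_pgf].
Qed.

(** The tail from n on carries a factor |x|^n, and the weights have total mass at most 1. The bound
    does not depend on s, so it survives averaging over a random parameter. *)
Lemma poisson_weight_pgf_error (R : realType) (s x : R) n :
  0 <= s -> `|x| <= 1 ->
  `|\sum_(0 <= m < n) poisson_weight s m * x ^+ m - expR (- (s * (1 - x)))|
    <= `|x| ^+ n.
Proof.
move=> s0 x1.
have hc := @cvg_poisson_weight_pgf R s x.
set u := fun n : nat => _ in hc.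
rewrite -/(u n) distrC.
have hd : (fun N => `|u N - u n|) @ \oo --> `|expR (- (s * (1 - x))) - u n|.
  by apply: cvg_norm; apply: cvgB => //; exact: cvg_cst.
apply: (@cvgr_to_le _ _ _ _ _ _ _ hd).
near=> N.
have nN : (n <= N)%N by near: N; exact: nbhs_infty_ge.
rewrite /u (@big_cat_nat _ _ _ n 0%N N) //= addrAC subrr add0r.
apply: (le_trans (ler_norm_sum _ _ _)).
apply: (@le_trans _ _ (`|x| ^+ n * \sum_(n <= i < N) poisson_weight s i)).
  rewrite mulr_sumr big_nat_cond [leRHS]big_nat_cond; apply: ler_sum => i.
  rewrite andbT => /andP[ni _].
  rewrite normrM normrX ger0_norm ?poisson_weight_ge0 // mulrC.
  by apply: ler_wpM2r; rewrite ?poisson_weight_ge0 // ler_wiXn2l.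
rewrite -[leRHS]mulr1; apply: ler_wpM2l; first exact: exprn_ge0.
apply: (@le_trans _ _ (\sum_(0 <= i < N) poisson_weight s i)).
  rewrite [leRHS](@big_cat_nat _ _ _ n) //= lerDr.
  by apply: sumr_ge0 => i _; exact: poisson_weight_ge0.
(* At x = 1 the partial sum of the weights is e^(-s) times a partial sum of the exponential series,
   hence at most 1. *)
have := sum_poisson_weight_exprE s 1 N.
under eq_bigr do rewrite expr1n mulr1.
move=> ->; rewrite mulr1 -(expRxMexpNx_1 s) mulrC.
by apply: ler_wpM2r; rewrite ?expR_ge0 // series_exp_coeff_le.
Unshelve. all: by end_near. Qed.

Lemma measurable_poisson_weight (R : realType) (D : set R) m :
  measurable D -> measurable_fun D ((@poisson_weight R)^~ m).
Proof.
move=> mD; apply: measurable_funM.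
  by apply: measurable_funM => //; exact: exprn_measurable.
by apply: measurableT_comp => //; exact: oppr_measurable.
Qed.

Lemma continuous_poisson_weight (R : realType) m :
  continuous (fun s : R => poisson_weight s m).
Proof.
move=> s; apply: cvgM.
  by apply: cvgM; [exact: exprn_continuous|exact: cvg_cst].
apply: continuous_comp; first exact: opp_continuous.
exact: continuous_expR.
Qed.

(** * Limits of probabilities and conditioning on a discrete index *)

Lemma bounded_convergence (d : measure_display) (T : measurableType d)
    (R : realType) (P : probability T R) (f_ : nat -> T -> R) (f : T -> R) :
  (forall n, measurable_fun setT (f_ n)) ->
  (forall n w, 0 <= f_ n w <= 1) ->
  (forall w, f_ n w @[n --> \oo] --> f w) ->
  measurable_fun setT f /\
  (\int[P]_w (f_ n w)%:E @[n --> \oo] --> \int[P]_w (f w)%:E)%E.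
Proof.
move=> mf_ f01 ff.
have mf : measurable_fun setT f.
  by apply: (measurable_fun_cvg mf_) => w _; exact: ff.
split=> //.
have [|||||_ _ //] := @dominated_convergence _ _ _ P setT measurableT
  (fun n w => (f_ n w)%:E) (fun w => (f w)%:E) (EFin \o cst 1).
- by move=> n; exact/measurable_EFinP.
- exact/measurable_EFinP.
- by apply: aeW => w _; apply/fine_cvgP; split; [exact: nearW|exact: ff].
- exact: finite_measure_integrable_cst.
- apply: aeW => w n _ /=; rewrite lee_fin.
  by have /andP[f0 f1] := f01 n w; rewrite ger0_norm.
Qed.

(** The indicators are eventually constant at each point, so bounded convergence applies to them.
    Measurability of the limit event is obtained along the way. *)
Lemma probability_eventually (d : measure_display) (T : measurableType d)
    (R : realType) (P : probability T R) (E : nat -> set T) (F : set T) :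
  (forall n, measurable (E n)) ->
  (forall w, \forall n \near \oo, E n w <-> F w) ->
  measurable F /\ (P (E n) @[n --> \oo] --> P F).
Proof.
move=> mE EF.
have [] := @bounded_convergence _ _ _ P (fun n => \1_(E n)) \1_F.
- by move=> n; exact: measurable_indic.
- by move=> n w; rewrite indicE; case: (_ \in _); rewrite ?lexx ?ler01.
- move=> w; apply: cvg_near_cst; near=> n.
  have [h1 h2] : E n w <-> F w by near: n; exact: EF.
  rewrite !indicE; congr (_%:R); congr nat_of_bool.
  by apply/idP/idP; rewrite !inE.
move=> /measurable_indicP mF; split=> //.
rewrite -(setIT F) -(integral_indic P measurableT mF) //.
under [X in X @ _ --> _]eq_fun do
  rewrite -(setIT (E _)) -(integral_indic P measurableT (mE _)).
by [].
Unshelve. all: by end_near. Qed.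

(** The event is the disjoint union of its parts on which A takes the value k, and each part
    factorises by hypothesis. *)
Lemma probability_random_index (d : measure_display) (T : measurableType d)
    (R : realType) (P : probability T R) (A : T -> nat) (F : nat -> set T) :
  (forall k, measurable [set w | A w = k]) ->
  (forall k, measurable (F k)) ->
  (forall k, P ([set w | A w = k] `&` F k) = P [set w | A w = k] * P (F k))%E ->
  measurable [set w | F (A w) w] /\
  (P [set w | F (A w) w] = \sum_(k <oo) P [set w | A w = k] * P (F k))%E.
Proof.
move=> mA mF PAF.
have mAF k : measurable ([set w | A w = k] `&` F k) by exact: measurableI.
have -> : [set w | F (A w) w] = \bigcup_k ([set w | A w = k] `&` F k).
  apply/seteqP; split => [w /= Fw|w [k _ [/= <-]]] //.
  by exists (A w).
split; first exact: bigcup_measurable.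
rewrite measure_semi_bigcup //; last 2 first.
- by move=> i j _ _ [w [[/= <- _] [/= <- _]]].
- exact: bigcup_measurable.
by apply: eq_eseriesr => k _; exact: PAF.
Qed.

(** * A Poisson process evaluated at an independent random time *)

(** The right endpoint of the grid cell containing x lies strictly above x, by at most the mesh;
    strictness is what the filter [x^'+] requires. *)
Lemma cvg_discretize_right (R : realType) (x : R) : 0 <= x ->
  (Num.truncn (n.+1%:R * x)).+1%:R / n.+1%:R @[n --> \oo] --> x^'+.
Proof.
move=> x0 Q [e /= e0 He].
change (\forall n \near \oo, Q ((Num.truncn (n.+1%:R * x)).+1%:R / n.+1%:R)).
near=> n.
have n0 : 0 < n.+1%:R :> R by rewrite ltr0n.
have /andP[h1 h2] := Num.Theory.truncn_itv (mulr_ge0 (ltW n0) x0).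
set t := (Num.truncn _)%:R in h1; set t1 := (Num.truncn _).+1%:R.
have e1 : n.+1%:R^-1 < e.
  by near: n; exact: (near_infty_natSinv_lt (PosNum e0)).
have xt : x < t1 / n.+1%:R by rewrite ltr_pdivlMr // mulrC.
apply: He => //=.
rewrite distrC ger0_norm ?subr_ge0 ?(ltW xt) // ltrBlDr.
have -> : t1 = t + 1 by rewrite /t1 -natr1.
rewrite mulrDl mul1r addrC ltr_leD // ler_pdivrMr //.
by rewrite mulrC.
Unshelve. all: by end_near. Qed.

(** D is approximated from the right by variables with countably many values. For these,
    conditioning on the value gives the mean Poisson weight; right-continuity of N and continuity of
    the weights carry the identity to the limit. *)
Lemma subordinated_poisson_pmf (d : measure_display) (T : measurableType d)
    (R : realType) (P : probability T R) (lambda : R)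
    (N : R -> T -> nat) (D : T -> R) :
  0 < lambda ->
  measurable_fun setT D -> (forall w, 0 <= D w) ->
  (forall w (t : R), 0 <= t -> N u w @[u --> t^'+] --> N t w) ->
  (forall (s : R) k, 0 < s -> measurable [set w | N s w = k]) ->
  (forall s k, 0 < s ->
    P [set w | N s w = k] = (poisson_weight (lambda * s) k)%:E) ->
  (forall s k B, 0 < s -> measurable B ->
    P (D @^-1` B `&` [set w | N s w = k]) =
    (P (D @^-1` B) * P [set w | N s w = k])%E) ->
  forall m, measurable [set w | N (D w) w = m] /\
    P [set w | N (D w) w = m] =
    (\int[P]_w (poisson_weight (lambda * D w) m)%:E)%E.
Proof.
move=> l0 mD D0 Ncad mN PN indep m.
(* [J n w] is the index of the cell of mesh 1 / (n + 1) containing [D w], and [t n j] is the right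
   endpoint of cell j. These endpoints are positive even when D vanishes, so the hypotheses on N at
   positive times apply. *)
pose J n w := Num.truncn (n.+1%:R * D w).
pose t n j : R := j.+1%:R / n.+1%:R.
have t0 n j : 0 < t n j by rewrite divr_gt0 ?ltr0n.
have n0 n : 0 < n.+1%:R :> R by rewrite ltr0n.
have JE n j : [set w | J n w = j] = D @^-1` `[j%:R / n.+1%:R, t n j[.
  apply/seteqP; split=> w /=; rewrite in_itv /= ler_pdivrMr // ltr_pdivlMr //.
    move=> <-; rewrite [D w * _]mulrC; apply: Num.Theory.truncn_itv.
    by rewrite mulr_ge0 // ltW.
  rewrite [D w * _]mulrC => h; apply/eqP; rewrite /J Num.Theory.truncn_eq //.
  by rewrite mulr_ge0 // ltW.
have mJ n j : measurable [set w | J n w = j].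
  by rewrite JE -[X in measurable X]setTI; exact: mD.
have mJfun n (g : nat -> R) : measurable_fun setT (g \o J n).
  apply: (@measurableT_comp _ _ _ _ nat) => // _ B _; rewrite setTI.
  rewrite [X in measurable X](_ : _ = \bigcup_(j in B) [set w | J n w = j]).
    by apply: bigcup_measurable.
  by apply/seteqP; split=> [w Bw|w [j Bj /= ->//]]; exists (J n w).
have Dcvg w : t n (J n w) @[n --> \oo] --> (D w)^'+.
  exact: cvg_discretize_right.
have Dcvg' w : t n (J n w) @[n --> \oo] --> D w.
  by apply: cvg_trans (Dcvg w) _; exact: cvg_within.
have step n : measurable [set w | N (t n (J n w)) w = m] /\
    P [set w | N (t n (J n w)) w = m] =
    (\int[P]_w (poisson_weight (lambda * t n (J n w)) m)%:E)%E.
  have [] := @probability_random_index _ _ _ P (J n)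
      (fun j => [set w | N (t n j) w = m]).
  - exact: mJ.
  - by move=> j; exact: mN.
  - by move=> j; rewrite JE; exact: indep.
  move=> mE PE; split; first exact: mE.
  rewrite PE.
  have UT : \bigcup_j [set w | J n w = j] = setT.
    by apply/seteqP; split=> // w _; exists (J n w).
  rewrite -[in RHS]UT ge0_integral_bigcup //=.
  - apply: eq_eseriesr => j _; rewrite PN //.
    rewrite (eq_integral (fun=> (poisson_weight (lambda * t n j) m)%:E)).
      by rewrite integral_cst // muleC.
    by move=> w; rewrite inE /= => ->.
  - rewrite UT; apply/measurable_EFinP.
    exact (mJfun n (fun j => poisson_weight (lambda * t n j) m)).
  - by move=> w _; rewrite lee_fin poisson_weight_ge0 // mulr_ge0 // ltW.
  - by move=> i j _ _ [w [/= h1 h2]]; rewrite -h1.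
have [||mE PE] := @probability_eventually _ _ _ P
    (fun n => [set w | N (t n (J n w)) w = m]) [set w | N (D w) w = m].
- by move=> n; exact: (step n).1.
- move=> w.
  (* The values of N lie in a discrete space, so right-continuity means being constant just after
     [D w]. *)
  have : \forall u \near (D w)^'+, N u w = N (D w) w.
    exact: (Ncad w (D w) (D0 w) _ (discrete_set1 _)).
  move=> /(Dcvg w) h; near=> n => /=.
  by rewrite (_ : N (t n (J n w)) w = N (D w) w) //; near: n; exact: h.
split=> //.
(* The probabilities of the discretised events also converge to the integral, by bounded
   convergence; the two limits must agree. *)
apply: (cvg_unique _ PE) => //.
rewrite (_ : (fun n => P _) =
    fun n => (\int[P]_w (poisson_weight (lambda * t n (J n w)) m)%:E)%E);
    last first.
  by apply/funext => n; exact: (step n).2.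
have [||| _ //] := @bounded_convergence _ _ _ P
  (fun n w => poisson_weight (lambda * t n (J n w)) m)
  (fun w => poisson_weight (lambda * D w) m).
- move=> n.
  exact (mJfun n (fun j => poisson_weight (lambda * t n j) m)).
- move=> n w; have h : 0 <= lambda * t n (J n w) by rewrite mulr_ge0 // ltW.
  by rewrite poisson_weight_ge0 // poisson_weight_le1.
- move=> w.
  have h : lambda * t n (J n w) @[n --> \oo] --> lambda * D w.
    by apply: cvgMr; exact: Dcvg'.
  exact: (cvg_comp _ _ h (@continuous_poisson_weight R m (lambda * D w))).
Unshelve. all: by end_near. Qed.

(** * Exponential mixing and the law of the geometric counting process *)

(** A density g makes nu absolutely continuous, and g agrees almost everywhere with the
    Radon-Nikodym derivative, for which the change of variables is known. *)
Lemma ge0_integral_density (d : measure_display) (T : measurableType d)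
    (R : realType) (m : {sigma_finite_measure set T -> \bar R})
    (nu : {finite_measure set T -> \bar R}) (g : T -> \bar R)
    (D : set T) (f : T -> \bar R) :
  measurable_fun setT g ->
  (forall A, measurable A -> nu A = (\int[m]_(x in A) g x)%E) ->
  measurable D -> measurable_fun D f -> (forall x, 0 <= f x)%E ->
  (\int[nu]_(x in D) f x = \int[m]_(x in D) (f x * g x))%E.
Proof.
move=> mg nug mD mf f0.
have dom : nu `<< m.
  apply/null_content_dominatesP => A mA mA0.
  by rewrite nug // null_set_integral //; exact: measurable_funTS.
rewrite -(Radon_Nikodym_SigmaFinite.change_of_variables dom f0 mD mf).
have iR := Radon_Nikodym_SigmaFinite.f_integrable dom.
apply: ae_eq_integral => //.
- apply: emeasurable_funM => //.
  exact: measurable_funTS (measurable_int _ iR).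
- by apply: emeasurable_funM => //; exact: measurable_funTS.
- apply: ae_eqe_mul2l; apply: integral_ae_eq => //.
  + exact: (integrableS measurableT).
  + exact: measurable_funTS.
  + move=> E _ mE.
    by rewrite -nug // (Radon_Nikodym_SigmaFinite.f_integral dom).
Qed.

Lemma integral_exponential_pdf_pos (R : realType) (r : R) : 0 < r ->
  (\int[lebesgue_measure]_(x in `]0%R, +oo[) (exponential_pdf r x)%:E = 1)%E.
Proof.
move=> r0; rewrite integral_itv_obnd_cbnd; last first.
  by apply/measurable_EFinP/measurable_funTS; exact: measurable_exponential_pdf.
rewrite -(integral_exponential_pdf r0) integral_mkcond.
apply: eq_integral => x _; rewrite patchE.
case: ifPn => // /negP xI; rewrite lt0_exponential_pdf // ltNge.
by apply/negP => x0; apply: xI; rewrite inE /= in_itv /= x0.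
Qed.

(** On the positive half-line e^(-c x) times the density of rate r equals r / (r + c) times the
    density of rate r + c, which has mass 1. *)
Lemma exponential_laplace (d : measure_display) (T : measurableType d)
    (R : realType) (P : probability T R) (L : {RV P >-> R}) (r c : R) :
  0 < r -> 0 <= c ->
  (forall B : set R, measurable B -> P (L @^-1` B) = exponential_prob r B) ->
  (\int[P]_(w in L @^-1` `]0%R, +oo[) (expR (- (c * L w)))%:E =
  (r / (r + c))%:E)%E.
Proof.
move=> r0 c0 PL.
have mexp : measurable_fun [set: R] (fun x : R => expR (- (c * x))).
  apply: measurableT_comp => //; apply: measurableT_comp => //.
(* [lebesgue_measure] lives on [measurableTypeR R], which has the same measurable
   sets as [R] but is not unifiable with it as a [measurableType]. *)
have mL : measurable_fun setT (L : T -> measurableTypeR R).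
  by move=> _ B mB; rewrite setTI; exact: (measurable_funPTI L).
pose L' : {RV P >-> measurableTypeR R} :=
  HB.pack (L : T -> measurableTypeR R) (isMeasurableFun.Build _ _ _ _ _ mL).
pose nu : {finite_measure set (measurableTypeR R) -> \bar R} :=
  distribution P L'.
have -> : (\int[P]_(w in L @^-1` `]0%R, +oo[) (expR (- (c * L w)))%:E =
   \int[nu]_(x in `]0%R, +oo[) (expR (- (c * x)))%:E)%E.
  rewrite ge0_integral_pushforward //.
  by apply/measurable_EFinP/measurable_funTS.
rewrite (@ge0_integral_density _ _ R lebesgue_measure nu
  (EFin \o exponential_pdf r)) //.
- rewrite (eq_integral (fun x : measurableTypeR R =>
      (r / (r + c))%:E * (exponential_pdf (r + c) x)%:E)%E).
    rewrite ge0_integralZl //.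
    + by rewrite integral_exponential_pdf_pos ?mule1 // ltr_wpDr.
    + apply/measurable_EFinP/measurable_funTS.
      exact: measurable_exponential_pdf.
    + by move=> x _; rewrite lee_fin exponential_pdf_ge0 // addr_ge0 // ltW.
    + by rewrite lee_fin divr_ge0 // ?addr_ge0 // ltW.
  move=> x; rewrite inE /= in_itv /= andbT => x0.
  rewrite -!EFinM !exponential_pdfE ?(ltW x0) //; congr (_%:E).
  have -> : - (r + c) * x = - (c * x) + - r * x by ring.
  by rewrite expRD; field; rewrite gt_eqF // ltr_wpDr.
- by apply/measurable_EFinP; exact: measurable_exponential_pdf.
- by apply/measurable_EFinP/measurable_funTS.
Qed.

(** Given L, the generating function is the Poisson one, e^(-t (1 - z) L). Averaging over L is the
    Laplace transform of the exponential law of rate 1 / mu at t (1 - z). As z >= 0, sum and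
    integral may be exchanged. *)
Lemma geometric_counting_pgf (d : measure_display) (T : measurableType d)
    (R : realType) (P : probability T R) (mu t z : R)
    (G : R -> {RV P >-> nat}) :
  0 < mu -> 0 <= t -> 0 <= z <= 1 -> geometric_counting_process P mu G ->
  (\sum_(k <oo) P [set w | G t w = k] * (z ^+ k)%:E =
  ((1 + mu * t * (1 - z))^-1)%:E)%E.
Proof.
move=> mu0 t0 /andP[z0 z1] [[G0 _ _] [L [PL GL]]].
(* Time 0 is treated apart, since the mixed Poisson law is given along strictly increasing times
   only. *)
have [->|tn0] := eqVneq t 0.
  rewrite mulr0 mul0r addr0 invr1.
  rewrite (eq_eseriesr (g := fun k => if k == 0%N then 1%E else 0%E)).
    apply/cvg_lim => //; apply: cvg_near_cst; exists 1%N => //= -[//|n] _.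
    by rewrite big_nat_recl //= big1 ?adde0.
  move=> [|k] _ /=.
    rewrite (_ : [set w | _] = setT) ?probability_setT ?mule1 //.
    by apply/seteqP; split=> // w _ /=.
  rewrite (_ : [set w | _] = set0) ?measure0 ?mul0e //.
  by apply/seteqP; split=> // w /=; rewrite G0.
have tp : 0 < t by rewrite lt_neqAle eq_sym tn0.
have mui : 0 < mu^-1 by rewrite invr_gt0.
have mI : measurable (`]0, +oo[%classic : set R) by [].
have mLI : measurable (L @^-1` `]0, +oo[) by exact: measurable_funPTI.
have mG k : measurable [set w | G t w = k].
  exact: (measurable_funPTI (G t) (Y := [set k])).
have PLI : P (L @^-1` `]0, +oo[) = 1%E.
  by rewrite PL // /exponential_prob integral_exponential_pdf_pos.
have Gpmf k : P [set w | G t w = k] =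
    (\int[P]_(w in L @^-1` `]0%R, +oo[) (poisson_weight (L w * t) k)%:E)%E.
  (* L is almost surely positive, so the event may be cut down to L > 0, where [poisson_pmf] and
     [poisson_weight] agree. *)
  have -> : P [set w | G t w = k] =
      P ([set w | G t w = k] `&` L @^-1` `]0, +oo[).
    have PLC : P (~` (L @^-1` `]0, +oo[)) = 0%E.
      by rewrite probability_setC // PLI subee.
    rewrite -[in LHS](setUIDK [set w | G t w = k] (L @^-1` `]0, +oo[)).
    rewrite measureU0 //; [exact: measurableI|exact: measurableD|].
    apply: (subset_measure0 _ _ _ PLC); last by move=> w [].
      exact: measurableD.
    exact: measurableC.
  (* A single increment, from 0 to t; the multiples of t extend these two times to an increasing
     sequence. *)
  have := GL 1%N (fun i => i%:R * t) (fun=> k) _ _ _ mI.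
  rewrite (_ : [set w | forall i, _] = [set w | G t w = k]); last first.
    apply/seteqP; split=> w /=.
      by move=> /(_ 0%N isT); rewrite mul1r mul0r G0 subn0.
    by move=> <- [|//] _; rewrite mul1r mul0r G0 subn0.
  move=> ->; rewrite ?mul0r //.
    apply: eq_integral => w; rewrite inE /= in_itv /= andbT => Lw.
    by rewrite big_ord1 mul1r mul0r subr0 poisson_pmfE // mulr_gt0.
  by apply/increasing_seqP => n; rewrite ltr_pM2r // ltr_nat.
have mw k : measurable_fun (L @^-1` `]0, +oo[)
    (fun w => (poisson_weight (L w * t) k)%:E).
  apply/measurable_EFinP/measurable_funTS.
  apply: (measurableT_comp (measurable_poisson_weight k measurableT)).
  exact: measurable_funM.
under eq_eseriesr => k _.
  rewrite Gpmf muleC -ge0_integralZl //; last 2 first.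
  - move=> w; rewrite /= in_itv /= andbT => Lw.
    by rewrite lee_fin poisson_weight_ge0 // mulr_ge0 // ltW.
  - by rewrite lee_fin exprn_ge0.
  over.
rewrite -integral_nneseries //; last 2 first.
- by move=> k; apply: emeasurable_funM.
- move=> k w; rewrite /= in_itv /= andbT => Lw.
  rewrite -EFinM lee_fin mulr_ge0 ?exprn_ge0 // poisson_weight_ge0 //.
  by rewrite mulr_ge0 // ltW.
rewrite (eq_integral (fun w => (expR (- (t * (1 - z) * L w)))%:E)).
  rewrite (exponential_laplace mui) //.
    have q0 : 0 < 1 + mu * t * (1 - z).
      by rewrite ltr_wpDr // !mulr_ge0 ?subr_ge0 // ltW.
    congr (_%:E).
    have -> : mu^-1 + t * (1 - z) = mu^-1 * (1 + mu * t * (1 - z)).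
      by field; rewrite gt_eqF.
    by rewrite invfM mulrA divff ?gt_eqF // mul1r.
  by rewrite mulr_ge0 // subr_ge0.
move=> w _; under eq_eseriesr do rewrite -EFinM mulrC.
rewrite nneseries_poisson_weight_pgf; congr (expR _)%:E; ring.
Qed.

(** * Generating functions of mixtures *)

Lemma cvg_fine_nneseries (R : realType) (u : nat -> \bar R) :
  (forall k, 0 <= u k)%E -> (\sum_(k <oo) u k < +oo)%E ->
  \sum_(0 <= k < n) fine (u k) @[n --> \oo] --> fine (\sum_(k <oo) u k)%E.
Proof.
move=> u0 uoo.
have sfin : (\sum_(k <oo) u k)%E \is a fin_num.
  by rewrite ge0_fin_numE // nneseries_ge0.
have ufin k : u k \is a fin_num.
  rewrite ge0_fin_numE //; apply: le_lt_trans uoo.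
  apply: (le_trans _ (nneseries_lim_ge k.+1 _)) => //.
  by rewrite big_nat_recr //= leeDr // sume_ge0.
have : (\sum_(0 <= k < n) u k)%E @[n --> \oo] --> (\sum_(k <oo) u k)%E.
  exact: is_cvg_nneseries.
rewrite -{1}(fineK sfin) => /fine_cvgP[_].
rewrite (_ : fine \o _ = fun n => \sum_(0 <= k < n) fine (u k)) //.
by apply/funext => n /=; rewrite sum_fine.
Qed.

(** For fixed n, averaging the error bound with weights of mass at most 1 and letting K grow bounds
    the distance from the n-th partial sum to H by |x|^n; then n grows. The uniform error replaces
    an exchange of nonnegative sums, as x may be negative. *)
Lemma cvg_mixture_pgf (R : realType) (g p psi : nat -> R)
    (a : nat -> nat -> R) (x H : R) :
  `|x| < 1 ->
  (forall k, 0 <= g k) -> (forall K, \sum_(0 <= k < K) g k <= 1) ->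
  (forall m, \sum_(0 <= k < K) g k * a k m @[K --> \oo] --> p m) ->
  (forall k n, `|\sum_(0 <= m < n) a k m * x ^+ m - psi k| <= `|x| ^+ n) ->
  \sum_(0 <= k < K) g k * psi k @[K --> \oo] --> H ->
  pseries p x @ \oo --> H.
Proof.
move=> x1 g0 g1 ap err gH.
have bound n : `|pseries p x n - H| <= `|x| ^+ n.
  have c1 : \sum_(0 <= m < n) (\sum_(0 <= k < K) g k * a k m) * x ^+ m
      @[K --> \oo] --> pseries p x n.
    apply: cvg_big => [|m _]; first exact: add_continuous.
    by apply: cvgMl; exact: ap.
  have c2 : `|\sum_(0 <= m < n) (\sum_(0 <= k < K) g k * a k m) * x ^+ m -
      \sum_(0 <= k < K) g k * psi k| @[K --> \oo] --> `|pseries p x n - H|.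
    exact: cvg_norm (cvgB c1 gH).
  apply: (cvgr_to_le c2); apply: nearW => K /=.
  rewrite [X in `|X|](_ : _ = \sum_(0 <= k < K) g k *
      (\sum_(0 <= m < n) a k m * x ^+ m - psi k)); last first.
    under eq_bigr do rewrite mulr_suml.
    rewrite exchange_big /= -sumrB; apply: eq_bigr => k _.
    rewrite mulrBr mulr_sumr; congr (_ - _).
    by apply: eq_bigr => m _; rewrite mulrA.
  apply: (le_trans (ler_norm_sum _ _ _)).
  apply: (@le_trans _ _ (\sum_(0 <= k < K) g k * `|x| ^+ n)).
    by apply: ler_sum => k _; rewrite normrM ger0_norm // ler_wpM2l.
  by rewrite -mulr_suml ler_piMl // exprn_ge0.
have x0 : `|x| ^+ n @[n --> \oo] --> (0 : R).
  by apply: cvg_expr; rewrite normr_id.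
apply/cvgrPdist_le => e e0.
move/cvgrPdist_le : x0 => /(_ _ e0).
apply: filterS => n; rewrite sub0r normrN => hn.
by rewrite distrC (le_trans (bound n)) // (le_trans _ hn) // ler_norm.
Qed.

(** The pointwise error bound is integrated; all the functions involved are bounded, and the finite
    sum commutes with the integral. *)
Lemma poisson_mixture_pgf_error (d : measure_display) (T : measurableType d)
    (R : realType) (P : probability T R) (S : T -> R) (x : R) n :
  measurable_fun setT S -> (forall w, 0 <= S w) -> `|x| <= 1 ->
  `|\sum_(0 <= m < n) (\int[P]_w poisson_weight (S w) m) * x ^+ m -
    \int[P]_w expR (- (S w * (1 - x)))| <= `|x| ^+ n.
Proof.
move=> mS S0 x1.
have bint (f : T -> R) : measurable_fun setT f -> (forall w, `|f w| <= 1) ->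
    P.-integrable setT (EFin \o f).
  move=> mf f1; apply: (le_integrable measurableT _ _
    (finite_measure_integrable_cst P 1 measurableT)).
    exact/measurable_EFinP.
  by move=> w _ /=; rewrite lee_fin normr1.
have mw m : measurable_fun setT (fun w => poisson_weight (S w) m).
  exact: (measurableT_comp (measurable_poisson_weight m measurableT)).
have iw m : P.-integrable setT (EFin \o (fun w => poisson_weight (S w) m)).
  apply: bint => // w.
  by rewrite ger0_norm ?poisson_weight_ge0 // poisson_weight_le1.
have ie : P.-integrable setT (EFin \o (fun w => expR (- (S w * (1 - x))))).
  apply: bint => [|w].
    apply: measurableT_comp => //; apply: measurableT_comp => //.
    exact: measurable_funM.
  have h : 0 <= S w * (1 - x).
    by rewrite mulr_ge0 // subr_ge0 (le_trans _ x1) // ler_norm.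
  by rewrite ger0_norm ?expR_ge0 // expR_le1 oppr_le0.
have [iA ->] : P.-integrable setT
      (EFin \o (fun w => \sum_(0 <= m < n) poisson_weight (S w) m * x ^+ m)) /\
    \sum_(0 <= m < n) (\int[P]_w poisson_weight (S w) m) * x ^+ m =
    \int[P]_w (\sum_(0 <= m < n) poisson_weight (S w) m * x ^+ m).
  elim: n => [|n [iA IH]].
    under eq_fun do rewrite big_nil.
    rewrite big_nil Rintegral_cst // mul0r; split=> //.
    exact: finite_measure_integrable_cst.
  have iZ : P.-integrable setT
      (EFin \o (fun w => poisson_weight (S w) n * x ^+ n)).
    by apply: (integrableZr measurableT (x ^+ n) (iw n)).
  under eq_fun do rewrite big_nat_recr //=.
  split; first exact: (integrableD measurableT iA iZ).
  by rewrite RintegralD // big_nat_recr //= IH RintegralZr.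
rewrite -RintegralB //; apply: (le_trans (le_normr_Rintegral _ _)) => //.
  exact: (integrableB measurableT iA ie).
have <- : \int[P]_(w in setT) (`|x| ^+ n) = `|x| ^+ n.
  by rewrite Rintegral_cst // (congr1 fine (probability_setT P)) mulr1.
apply: le_Rintegral => //.
- exact: (integrable_norm (integrableB measurableT iA ie)).
- exact: finite_measure_integrable_cst.
- by move=> w _; exact: poisson_weight_pgf_error.
Qed.

(** * Events generated by a process *)

Lemma sigma_process_preimage (T : Type) (d' : measure_display)
    (E : measurableType d') (I : Type) (J : set I) (X : I -> T -> E) i B :
  J i -> measurable B -> sigma_process J X (X i @^-1` B).
Proof.
move=> Ji mB; apply: sub_sigma_algebra; exists i => //.
by exists B => //; rewrite setTI.
Qed.

Lemma measurable_partial_product (d : measure_display)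
    (T : measurableType d) (R : realType) (X : nat -> T -> R) m :
  (forall i, measurable_fun setT (X i)) ->
  measurable_fun setT (partial_product X m).
Proof.
move=> mX; elim: m => [|m IH].
  rewrite (_ : partial_product X 0 = cst 1) //.
  by apply/funext => w; rewrite /partial_product big_ord0.
rewrite (_ : partial_product X m.+1 = partial_product X m \* X m); last first.
  by apply/funext => w; rewrite /partial_product big_ord_recr.
exact: measurable_funM.
Qed.

(** Measurability of the partial product is applied with the sample space carrying the sigma-algebra
    generated by the factors, so that being measurable means belonging to [sigma_process]. *)
Lemma sigma_process_partial_product (d : measure_display)
    (T : measurableType d) (R : realType) (X : nat -> T -> R) m (B : set R) :
  measurable B -> sigma_process [set: nat] X (partial_product X m @^-1` B).
Proof.
pose S := g_sigma_algebraType
  (\bigcup_(i in [set: nat]) preimage_set_system [set: T] (X i) measurable).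
move=> mB; rewrite -[_ @^-1` _]setTI.
apply: (@measurable_partial_product _ S) => // i _ C mC; rewrite setTI.
exact: sigma_process_preimage.
Qed.

(** * Distribution function of the time-changed multiplicative process *)

Theorem proposition4p5 (d : measure_display) (T : measurableType d)
    (R : realType) (P : probability T R)
    (b : R) (nu : {measure set R -> \bar R}) (lambda mu : R)
    (D : R -> {RV P >-> R}) (N : R -> {RV P >-> nat})
    (X : nat -> {RV P >-> R}) (G : R -> {RV P >-> nat}) :
  let f := bernstein b nu in
  let Nf := subordinated N D in
  let Npi := mult_compound X Nf in
  let Y := time_changed Npi G in
  let V := partial_product X in
  0 <= b ->
  levy_measure_pos nu ->
  levy_subordinator P D ->
  (forall s t : R, 0 <= s -> 0 <= t ->
     ('E_P[(fun w => expR (- (s * D t w))%R)] = (expR (- (t * f s))%R)%:E)%E) ->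
  0 < lambda ->
  poisson_process P lambda N ->
  independent_processes P [set t : R | 0 <= t] N [set t : R | 0 <= t] D ->
  mutually_independent P X ->
  (forall (i : nat) (B : set R), measurable B ->
     distribution P (X i) B = distribution P (X 0%N) B) ->
  independent_processes P [set: nat] X [set t : R | 0 <= t] Nf ->
  0 < mu ->
  geometric_counting_process P mu G ->
  independent_processes P [set t : R | 0 <= t] G [set t : R | 0 <= t] Npi ->
  forall y t : R, 0 <= t ->
  let h := fun u : R => (1 + mu * t * (1 - expR (- f (lambda * u))))^-1 in
  (forall m : nat, derivable (h^`(m)%classic) 1 1) /\
  (1 + mu * t * (1 - expR (- f lambda)))^-1 * \1_(`[1, +oo[) y +
    \sum_(1 <= m < n.+1) (-1) ^+ m / m`!%:R *
       fine (P [set w | V m w <= y]) * h^`(m)%classic 1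
    @[n --> \oo] --> fine (P [set w | Y t w <= y]).
Proof.
move=> f Nf Npi Y V b0 _ [[D00 _ _ _] Dmono] laplace l0.
move=> [[N0 _ Ncad] _ Npois] indND _ _ indXN mu0 Ggeo indGN y t t0 h.
have D0 (s : R) w : 0 <= s -> 0 <= D s w by move=> s0; rewrite -(D00 w) Dmono.
have mNf (s : R) m : 0 <= s -> measurable [set w | Nf s w = m] /\
    P [set w | Nf s w = m] =
    (\int[P]_w (poisson_weight (lambda * D s w) m)%:E)%E.
  move=> s0; apply: (@subordinated_poisson_pmf _ _ _ P lambda
    (fun u => N u) (D s)) => //.
  - by move=> w; exact: D0.
  - by move=> w u u0; exact: (Ncad w).1.
  - by move=> u k _; exact: (measurable_funPTI (N u) (Y := [set k])).
  (* The value at u is the increment from time 0, because N starts at 0. *)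
  - move=> u k u0; rewrite -poisson_pmfE ?mulr_gt0 // -{2}(subr0 u) -Npois //.
    by congr (P _); apply/seteqP; split=> w /=; rewrite N0 subn0.
  - move=> u k B u0 mB; rewrite setIC muleC; apply: indND.
    + exact: (@sigma_process_preimage _ _ _ _ _ (fun u => N u) u
        [set k] (ltW u0)).
    + exact: (@sigma_process_preimage _ _ _ _ _ (fun u => D u)).
have VE m : [set w | V m w <= y] = V m @^-1` `]-oo, y].
  by apply/seteqP; split=> w /=; rewrite in_itv.
have mV m : measurable [set w | V m w <= y].
  by rewrite VE -[_ @^-1` _]setTI; exact: measurable_partial_product.
have PNpi (s : R) : 0 <= s -> measurable [set w | Npi s w <= y] /\
    P [set w | Npi s w <= y] =
    (\sum_(m <oo) P [set w | Nf s w = m] * P [set w | (V m w <= y)%R])%E.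
  move=> s0; apply: (@probability_random_index _ _ _ P (Nf s)
    (fun m => [set w | V m w <= y])) => //.
  - by move=> m; exact: (mNf s m s0).1.
  - move=> m; rewrite setIC muleC; apply: indXN.
      by rewrite VE; exact: sigma_process_partial_product.
    exact: (@sigma_process_preimage _ _ _ _ _ Nf s [set m] s0).
have mG k : measurable [set w | G t w = k].
  exact: (measurable_funPTI (G t) (Y := [set k])).
have [mY PY] : measurable [set w | Y t w <= y] /\ (P [set w | (Y t w <= y)%R] =
    \sum_(k <oo) P [set w | G t w = k] * P [set w | (Npi k%:R w <= y)%R])%E.
  apply: (@probability_random_index _ _ _ P (G t)
    (fun k => [set w | Npi k%:R w <= y])) => //.
  - by move=> k; exact: (PNpi k%:R (ler0n R k)).1.
  - move=> k; apply: indGN.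
      exact: (@sigma_process_preimage _ _ _ _ _ (fun u => G u) t [set k] t0).
    rewrite (_ : [set w | _] = Npi k%:R @^-1` `]-oo, y]); last first.
      by apply/seteqP; split=> w /=; rewrite in_itv.
    exact: (@sigma_process_preimage _ _ _ _ _ Npi k%:R _ (ler0n R k)).
pose g k := P [set w | G t w = k].
pose a k m := P [set w | Nf k%:R w = m].
pose v m := P [set w | V m w <= y].
pose p m := (\sum_(k <oo) g k * a k m)%E.
have gpgf z : 0 <= z <= 1 ->
    (\sum_(k <oo) g k * (z ^+ k)%:E = ((1 + mu * t * (1 - z))^-1)%:E)%E.
  by move=> z01; exact: geometric_counting_pgf.
have sg : (\sum_(k <oo) g k = 1)%E.
  have := gpgf 1; rewrite subrr mulr0 addr0 invr1 ler01 lexx => <- //.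
  by apply: eq_eseriesr => k _; rewrite expr1n mule1.
have gfin k : g k \is a fin_num by exact: fin_num_measure.
have afin k m : a k m \is a fin_num.
  by apply: fin_num_measure; exact: (mNf _ _ _).1.
have vfin m : v m \is a fin_num by exact: fin_num_measure.
have ga0 k m : (0 <= g k * a k m)%E by rewrite mule_ge0.
have p1 m : (p m <= 1)%E.
  rewrite -sg; apply: lee_nneseries => // k _.
  rewrite -[leRHS]mule1 lee_wpmul2l // probability_le1 //.
  exact: (mNf _ _ _).1.
have p0 m : (0 <= p m)%E by exact: nneseries_ge0.
have pfin m : p m \is a fin_num.
  by rewrite ge0_fin_numE // (le_lt_trans (p1 m)) // ltry.
have YE : (P [set w | (Y t w <= y)%R] = \sum_(m <oo) v m * p m)%E.
  rewrite PY (eq_eseriesr (g := fun k => \sum_(m <oo) v m * (g k * a k m))%E).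
    rewrite nneseries_interchange; last by move=> k m; rewrite mule_ge0.
    by apply: eq_eseriesr => m _; rewrite -(fineK (vfin m)) nneseriesZl.
  move=> k _; rewrite (PNpi k%:R (ler0n R k)).2.
  rewrite -/(g k) -(fineK (gfin k)) -nneseriesZl; last first.
    by move=> m _; rewrite mule_ge0.
  by apply: eq_eseriesr => m _; rewrite muleA muleC.
have f0 (u : R) : 0 <= u -> 0 <= f u.
  move=> u0; rewrite addr_ge0 ?mulr_ge0 //; apply: Rintegral_ge0 => x.
  rewrite /= in_itv /= andbT => x0.
  by rewrite subr_ge0 expR_le1 oppr_le0 mulr_ge0 // ltW.
have hp (x : R) : `|x| < 1 -> pseries (fine \o p) x @ \oo --> h (1 - x).
  move=> x1.
  have lx : 0 <= lambda * (1 - x).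
    by rewrite mulr_ge0 ?ltW // subr_gt0 (le_lt_trans _ x1) // ler_norm.
  pose z := expR (- f (lambda * (1 - x))).
  have z01 : 0 <= z <= 1 by rewrite expR_ge0 expR_le1 oppr_le0 f0.
  apply: (@cvg_mixture_pgf _ (fine \o g) _ (fun k => z ^+ k)
    (fun k m => fine (a k m))) => //.
  - by move=> k; exact: fine_ge0.
  - move=> K; rewrite -lee_fin -sumEFin -sg.
    rewrite (eq_bigr g); last by move=> k _; rewrite /= fineK.
    exact: nneseries_lim_ge.
  - move=> m; under eq_fun do under eq_bigr do rewrite /= -fineM //.
    by apply: cvg_fine_nneseries => //; rewrite (le_lt_trans (p1 m)) // ltry.
  - move=> k n.
    have := @poisson_mixture_pgf_error _ _ _ P
      (fun w => lambda * D k%:R w) x n _ _ (ltW x1).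
    (* This is the Laplace transform of D at time k and argument lambda (1 - x), which is
       nonnegative as |x| < 1; its exponent is linear in k, whence the power of z. *)
    rewrite (_ : \int[P]_w _ = z ^+ k); last first.
      have := laplace _ k%:R lx (ler0n R k).
      rewrite unlock => /(congr1 fine) /= E.
      rewrite /z -expRM_natl mulrN -E; congr fine; apply: eq_integral => w _.
      by congr (expR _)%:E; ring.
    under eq_bigr do rewrite /Rintegral -(mNf _ _ (ler0n R k)).2.
    apply; first exact: measurable_funM.
    by move=> w; rewrite mulr_ge0 ?D0 // ltW.
  - have := @cvg_fine_nneseries R (fun k => g k * (z ^+ k)%:E)%E.
    rewrite gpgf //= => /(_ _ (ltry _)).
    under eq_fun do under eq_bigr do rewrite fineM //.
    apply; move=> k; rewrite mule_ge0 // lee_fin exprn_ge0 //.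
    by case/andP: z01.
have dh := derive1n_pseries_onem hp.
split=> [m|]; first exact: (dh m).1.
have -> : (fun n => (1 + mu * t * (1 - expR (- f lambda)))^-1 * \1_(`[1, +oo[) y +
    \sum_(1 <= m < n.+1) (-1) ^+ m / m`!%:R *
       fine (P [set w | V m w <= y]) * h^`(m)%classic 1) =
    (fun n => \sum_(0 <= m < n.+1) fine (v m * p m)%E).
  (* The isolated term is the one for m = 0: h(1) is p_0, and the empty product V_0 = 1 yields the
     indicator of y >= 1. *)
  apply/funext => n; rewrite [RHS]big_nat_recl // big_add1; congr (_ + _).
    have -> : (1 + mu * t * (1 - expR (- f lambda)))^-1 = fine (p 0%N).
      have := (dh 0%N).2; rewrite expr0 fact0 !mul1r /= => <-.
      by rewrite /derive1n /= /h mulr1.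
    rewrite fineM // mulrC; congr (_ * _).
    rewrite /v indicE (_ : (y \in _) = (1 <= y)); last first.
      by apply/idP/idP; rewrite inE /= in_itv /= andbT.
    have [y1|y1] := leP 1 y.
      rewrite (_ : [set w | _] = setT) ?probability_setT //.
      by apply/seteqP; split=> // w _; rewrite /= /V /partial_product big_ord0.
    rewrite (_ : [set w | _] = set0) ?measure0 //.
    apply/seteqP; split=> // w.
    by rewrite /= /V /partial_product big_ord0 leNgt y1.
  apply: eq_bigr => m _; rewrite fineM // (dh m.+1).2 /=.
  (* The sign and the factorial in the derivative of h at 1 cancel those of the formula, since e
     squares to 1 and c is nonzero. *)
  set e : R := (-1) ^+ m.+1; set c : R := m.+1`!%:R.
  have c0 : c != 0 by rewrite pnatr_eq0 -lt0n fact_gt0.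
  have ee : e * e = 1 by rewrite -expr2 sqrr_sign.
  transitivity ((e * e) * (fine (v m.+1) * fine (p m.+1))); first by field.
  by rewrite ee mul1r.
rewrite (cvg_shiftS (fun n => \sum_(0 <= m < n) fine (v m * p m)%E)) YE.
apply: cvg_fine_nneseries => [m|]; first by rewrite mule_ge0.
by rewrite -YE (le_lt_trans (probability_le1 P mY)) ?ltry.
Qed.
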